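(* Let $D$ be an integral domain with quotient field $K$, let $A$ be a finitely generated, torsion-free $D$-algebra (possibly non-commutative), let $B=A\otimes_D K$, and assume that $A\cap K=D$ when $A$ and $K$ are canonically embedded in $B$. Let $S\subseteq A$. Then $S$ is a right ringset if and only if, for all non-zero $d\in D$, the set $S+dA$, as a subset of the ring $A/dA$, is a right null-ideal set.
   Context: Rings are associative with identity, not necessarily commutative (the zero ring is allowed). For a ring $R$, $R[x]$ is the usual polynomial ring, whose indeterminate $x$ commutes with all elements of $R$. A polynomial $f=\sum_k c_kx^k\in R[x]$ induces the right polynomial function $f_r(s)=\sum_k c_k s^k$ on $R$. With $D,K,A,B$ as in the claim and $S\subseteq A$, define $$\operatorname{Int}^r_B(S,A)=\{f\in B[x]\mid \forall s\in S:\ f_r(s)\in A\}.$$ $S$ is called a right ringset if $\operatorname{Int}^r_B(S,A)$ is closed under multiplication in $B[x]$ (and hence a ring). For an ideal $I$ of $A$, $S+I$ denotes the set of residue classes $\{s+I\mid s\in S\}\subseteq A/I$. For a ring $R$ and a subset $U\subseteq R$, let $N^r_R(U)=\{f\in R[x]\mid \forall s\in U:\ f_r(s)=0\}$. This is always a left ideal of $R[x]$. $U$ (as a subset of $R$) is called a right null-ideal set if $N^r_R(U)$ is a right ideal (hence a two-sided ideal) of $R[x]$. In the claim this is used with $R=A/dA$ and $U=S+dA$. *)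

(* Defs.v *)
From HB Require Import structures.
From mathcomp Require Import all_boot all_order all_algebra.
From mathcomp Require Import generic_quotient ring_quotient sesquilinear.
From mathcomp Require Import boolp classical_sets.

Set Implicit Arguments.
Unset Strict Implicit.
Unset Printing Implicit Defensive.

Import GRing.Theory.

Local Open Scope ring_scope.
Local Open Scope quotient_scope.
Local Open Scope classical_set_scope.

Section TensorProduct.
Variables (D : idomainType).
Local Notation K := {fraction D}.

(* Restriction of scalars along D -> K: the K-module V, seen as a D-module. *)
Definition restr (V : lmodType K) : Type := V.

Section Restr.
Variable V : lmodType K.
HB.instance Definition _ := GRing.Zmodule.on (restr V).

Definition restr_scale (d : D) (v : restr V) : restr V :=
  (FracField.tofrac d : K) *: (v : V).

Lemma restr_scalerA d e v :
  restr_scale d (restr_scale e v) = restr_scale (d * e) v.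
Proof. by rewrite /restr_scale scalerA -rmorphM. Qed.
Lemma restr_scale1r : left_id 1 restr_scale.
Proof. by move=> v; rewrite /restr_scale rmorph1 scale1r. Qed.
Lemma restr_scalerDr : right_distributive restr_scale +%R.
Proof. by move=> d u v; exact: scalerDr. Qed.
Lemma restr_scalerDl v : {morph restr_scale^~ v : d e / d + e}.
Proof. by move=> d e; rewrite /restr_scale rmorphD; exact: scalerDl. Qed.

HB.instance Definition _ := GRing.Zmodule_isLmodule.Build D (restr V)
  restr_scalerA restr_scale1r restr_scalerDr restr_scalerDl.
End Restr.

Definition is_tensor_product (U V T : lmodType D)
    (t : {bilinear U -> V -> T}) : Prop :=
  forall (W : lmodType D) (phi : {bilinear U -> V -> W}),
    exists g : {linear T -> W},
      (forall u v, g (t u v) = phi u v) /\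
      (forall g' : {linear T -> W},
         (forall u v, g' (t u v) = phi u v) -> g' =1 g).

(* B, with (a, k) |-> t a k as the map (a, k) |-> a (x) k, is the K-algebra
   A (x)_D K; the universal property determines B as a D-module and the other
   three fields are the usual ring and K-module structures. *)
Record is_tensor_algebra (A : algType D) (B : algType K)
    (t : {bilinear A -> restr K^o -> restr B}) : Prop := IsTensorAlgebra {
  tensor_universal : is_tensor_product t;
  tensor_one : t 1 (1 : K) = (1 : B);
  tensor_mul : forall (a b : A) (k l : K),
    t (a * b) (k * l) = (t a k : B) * (t b l : B);
  tensor_scale : forall (a : A) (k l : K),
    t a (k * l) = k *: (t a l : B) }.

Section Embeddings.
Variables (A : algType D) (B : algType K).
Variable t : {bilinear A -> restr K^o -> restr B}.

Definition iotaA (a : A) : B := t a (1 : K).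
Definition iotaK (k : K) : B := t 1 k.

Definition A_cap_K_eq_D : Prop :=
  range iotaA `&` range iotaK =
  [set iotaK (FracField.tofrac d) | d in [set: D]].

(* MathComp's f.[x] is the sum of the f`_k * x ^+ k: the coefficients stand on
   the left, so that it is the right polynomial function f_r also when the
   coefficients do not commute with x. *)
Definition Int_r (S : set A) : set {poly B} :=
  [set f : {poly B} | forall s, S s -> range iotaA f.[iotaA s]].

Definition right_ringset (S : set A) : Prop :=
  forall f g : {poly B}, Int_r S f -> Int_r S g -> Int_r S (f * g).
End Embeddings.
End TensorProduct.

Section Algebras.
Variables (D : idomainType) (A : algType D).

Definition torsion_free : Prop :=
  forall (d : D) (a : A), d != 0 -> d *: a = 0 -> a = 0.

Inductive gen_subalg (G : seq A) : A -> Prop :=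
| gen_in a : a \in G -> gen_subalg G a
| gen_scalar d : gen_subalg G d%:A
| gen_add a b : gen_subalg G a -> gen_subalg G b -> gen_subalg G (a + b)
| gen_mul a b : gen_subalg G a -> gen_subalg G b -> gen_subalg G (a * b).

Definition fin_gen_algebra : Prop :=
  exists G : seq A, forall a, gen_subalg G a.
End Algebras.

Section QuotientByScalar.
Variables (D : idomainType) (A : algType D) (d : D).

Definition dA : {pred A} := fun x => `[< exists a, x = d *: a >].

Lemma dA_zmod_closed : zmod_closed dA.
Proof.
split; first by apply/asboolP; exists 0; rewrite scaler0.
move=> _ _ /asboolP[a ->] /asboolP[b ->].
by apply/asboolP; exists (a - b); rewrite scalerBr.
Qed.
HB.instance Definition _ := GRing.isZmodClosed.Build A dA dA_zmod_closed.

Lemma dA_mull (a x : A) : x \in dA -> a * x \in dA.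
Proof.
by move=> /asboolP[b ->]; apply/asboolP; exists (a * b); rewrite scalerAr.
Qed.
Lemma dA_mulr (a x : A) : x \in dA -> x * a \in dA.
Proof.
by move=> /asboolP[b ->]; apply/asboolP; exists (b * a); rewrite scalerAl.
Qed.

(* The ring A / dA, which is zero when d is a unit.  It is built here because
   ring_quotient only has the quotient of a commutative ring by a proper
   ideal; its additive group is the library's. *)
Definition quot_dA : Type := Quotient.quot dA.
HB.instance Definition _ := EqQuotient.on quot_dA.
HB.instance Definition _ := GRing.Zmodule.on quot_dA.

Definition pi_dA (a : A) : quot_dA := \pi_(Quotient.quot dA) a.
Definition one_dA : quot_dA := pi_dA 1.
Definition mul_dA (x y : quot_dA) : quot_dA := pi_dA (repr x * repr y).

Lemma pi_dA_eq a b : (pi_dA a = pi_dA b) <-> (a - b \in dA).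
Proof.
rewrite /pi_dA (Quotient.idealrBE dA a b).
by split=> [-> | /eqP].
Qed.

Lemma pi_dA_mul a b : pi_dA (a * b) = mul_dA (pi_dA a) (pi_dA b).
Proof.
have reprB c : c - repr (pi_dA c) \in dA.
  by apply/pi_dA_eq; rewrite /pi_dA [RHS]reprK.
apply/pi_dA_eq; set a' := repr _; set b' := repr _.
have -> : a * b - a' * b' = (a - a') * b + a' * (b - b').
  by rewrite mulrBl mulrBr addrA subrK.
by apply: rpredD; [apply: dA_mulr | apply: dA_mull]; exact: reprB.
Qed.

Lemma pi_dAD a b : pi_dA (a + b) = pi_dA a + pi_dA b.
Proof. by rewrite /pi_dA; exact: (raddfD (\pi_(Quotient.quot dA))). Qed.

Lemma pi_dAP (x : quot_dA) : {a | x = pi_dA a}.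
Proof. by exists (repr x); rewrite /pi_dA [RHS]reprK. Qed.

Lemma mul_dAA : associative mul_dA.
Proof.
move=> x y z; have [[[a ->] [b ->]] [c ->]] := (pi_dAP x, pi_dAP y, pi_dAP z).
by rewrite -!pi_dA_mul mulrA.
Qed.
Lemma mul1_dA : left_id one_dA mul_dA.
Proof. by move=> x; have [a ->] := pi_dAP x; rewrite -pi_dA_mul mul1r. Qed.
Lemma mul_dA1 : right_id one_dA mul_dA.
Proof. by move=> x; have [a ->] := pi_dAP x; rewrite -pi_dA_mul mulr1. Qed.
Lemma mul_dADl : left_distributive mul_dA +%R.
Proof.
move=> x y z; have [[[a ->] [b ->]] [c ->]] := (pi_dAP x, pi_dAP y, pi_dAP z).
by rewrite -pi_dAD -!pi_dA_mul -pi_dAD mulrDl.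
Qed.
Lemma mul_dADr : right_distributive mul_dA +%R.
Proof.
move=> x y z; have [[[a ->] [b ->]] [c ->]] := (pi_dAP x, pi_dAP y, pi_dAP z).
by rewrite -pi_dAD -!pi_dA_mul -pi_dAD mulrDr.
Qed.

HB.instance Definition _ := GRing.Zmodule_isPzRing.Build quot_dA
  mul_dAA mul1_dA mul_dA1 mul_dADl mul_dADr.

Definition coset_set (S : set A) : set quot_dA := [set pi_dA s | s in S].
End QuotientByScalar.

Arguments quot_dA {D} A d.
Arguments pi_dA {D A} d a.
Arguments coset_set {D A} d S.

(* {poly R} requires 1 != 0 in R: nontriv nz is R together with this fact. *)
Definition nontriv (R : pzRingType) (nz : (1 : R) != 0) : Type := R.

Section Nontriv.
Variables (R : pzRingType) (nz : (1 : R) != 0).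
HB.instance Definition _ := GRing.PzRing.on (nontriv nz).
HB.instance Definition _ := GRing.PzSemiRing_isNonZero.Build (nontriv nz) nz.
End Nontriv.

Definition right_ideal (R : pzRingType) (I : set R) : Prop :=
  [/\ I 0, forall x y, I x -> I y -> I (x - y)
    & forall x r, I x -> I (x * r)].

Definition null_polys (R : nzRingType) (U : set R) : set {poly R} :=
  [set f : {poly R} | forall s, U s -> f.[s] = 0].

(* If 1 = 0 in R, then R[x] is the zero ring, and the set of null polynomials
   is a right ideal for every U; this is the case in which the premise nz
   fails. *)
Definition right_null_ideal_set (R : pzRingType) (U : set R) : Prop :=
  forall nz : (1 : R) != 0, right_ideal (null_polys (U : set (nontriv nz))).

(* Main.v *)
(** Since [A] is torsion-free, it embeds in [B], and every [f] in [B[x]] is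
    [F / d] with [F] in [A[x]] and [d] in [D] non-zero; so [f] is integer-valued
    on [S] iff [F] is null on [S] modulo [dA].  If integer-valued polynomials
    are closed under multiplication and [F] is null modulo [dA], then
    [(F / d) G] is integer-valued, that is, [F G] is null modulo [dA].
    Conversely [(f g)(s) = (f b)(s)] for the constant [b = g(s)]; when [b] is in
    [A], [f b = F b / d], and [F b] is null modulo [dA] as soon as [F] is. *)
Require Import Defs.
From HB Require Import structures.
From mathcomp Require Import all_boot all_order all_algebra.
From mathcomp Require Import generic_quotient ring_quotient sesquilinear.
From mathcomp Require Import boolp classical_sets functions.
From mathcomp Require Import ring.

Import GRing.Theory.

Local Open Scope ring_scope.

(** * Quotients of modules by submodules *)

Section QuotientModule.
Variables (R : pzRingType) (M : lmodType R) (N : zmodClosed M).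
Hypothesis scaleN : forall a, {in N, forall x, a *: x \in N}.

(** The closure proof is a parameter of the type, so that the scaling built from it can be a
    canonical instance. *)
Definition quot_mod (_ : forall a, {in N, forall x, a *: x \in N}) : Type :=
  Quotient.quot N.
Local Notation Q := (quot_mod scaleN).
HB.instance Definition _ := GRing.Zmodule.on Q.

Let pi (x : M) : Q := (\pi_(Quotient.quot N) x)%qT.

Let pi_eq x y : pi x = pi y <-> x - y \in N.
Proof.
rewrite (Quotient.idealrBE N x y).
by split=> [E | /eqP //]; apply/eqP.
Qed.

Let piD : {morph pi : x y / x + y}.
Proof. exact: (raddfD (\pi_(Quotient.quot N)%qT)). Qed.

Let piK (x : Q) : pi (repr (x : Quotient.quot N)) = x.
Proof. exact: (@reprK _ (Quotient.quot N)). Qed.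

Let scale (a : R) (x : Q) : Q := pi (a *: repr (x : Quotient.quot N)).

Let piZ a x : scale a (pi x) = pi (a *: x).
Proof. by apply/pi_eq; rewrite -scalerBr; apply/scaleN/pi_eq/piK. Qed.

Let scaleA a b x : scale a (scale b x) = scale (a * b) x.
Proof. by rewrite piZ scalerA. Qed.

Let scale1 : left_id 1 scale.
Proof. by move=> x; rewrite /scale scale1r piK. Qed.

Let scaleDr : right_distributive scale +%R.
Proof.
by move=> a x y; rewrite -(piK x) -(piK y) -piD !piZ scalerDr piD.
Qed.

Let scaleDl x : {morph scale^~ x : a b / a + b}.
Proof. by move=> a b; rewrite /scale scalerDl piD. Qed.

HB.instance Definition _ :=
  GRing.Zmodule_isLmodule.Build R Q scaleA scale1 scaleDr scaleDl.

Let pi_linear : linear pi.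
Proof. by move=> a x y; rewrite piD -piZ. Qed.

HB.instance Definition _ := GRing.isLinear.Build R M Q *:%R pi pi_linear.

Lemma quot_mod_exists :
  exists (P : lmodType R) (p : {linear M -> P}),
    forall x, p x = 0 <-> x \in N.
Proof.
exists Q, pi => x.
have <- : pi 0 = 0 by exact: (raddf0 (\pi_(Quotient.quot N)%qT)).
by rewrite pi_eq subr0.
Qed.

End QuotientModule.

(** Closure under opposites is scaling by [-1]. Later arguments use the quotient only through a
    linear map with prescribed kernel. *)
Lemma quotient_module (R : pzRingType) (M : lmodType R) (N : M -> Prop) :
  N 0 -> (forall x y, N x -> N y -> N (x + y)) ->
  (forall a x, N x -> N (a *: x)) ->
  exists (P : lmodType R) (p : {linear M -> P}), forall x, p x = 0 <-> N x.
Proof.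
move=> N0 ND NZ.
pose S : {pred M} := fun x => `[< N x >].
have clS : zmod_closed S.
  split=> [|x y /asboolP Nx /asboolP Ny]; apply/asboolP => //.
  by apply: ND => //; rewrite -scaleN1r; exact: NZ.
pose cS := GRing.isZmodClosed.Build M S clS.
pose zS : zmodClosed M := HB.pack S cS.
have [|P [p kerp]] := @quot_mod_exists R M zS.
  by move=> a x /asboolP Nx; apply/asboolP; exact: NZ.
exists P, p => x; rewrite kerp.
by split=> [/asboolP | Nx]; [|exact/asboolP].
Qed.

(** * Denominators, and the embedding of [A] in [B] *)

Lemma frac_denom (D : idomainType) (k : {fraction D}) :
  exists d n : D,
    d != 0 /\ FracField.tofrac d * k = FracField.tofrac n.
Proof.
elim/quotW: k => x; exists \d_x, \n_x; split; first exact: denom_ratioP.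
apply/eqP; rewrite -[_ * _]/(FracField.mul _ _) !piE /FracField.equivf /=.
rewrite /FracField.mulf /= !numden_Ratio ?oner_neq0 ?mul1r ?denom_ratioP //.
by rewrite !mulr1.
Qed.

Section TensorAlgebra.
Variables (D : idomainType) (A : algType D).
Local Notation K := {fraction D}.
Local Notation "x %:F" := (@FracField.tofrac D x).

(* Junk value unless [d%:F * k] lies in [D]. *)
Definition mul_num (k : K) (d : D) : D := xget 0 [set n | d%:F * k = n%:F].

Lemma mul_numE (k : K) (d n : D) : d%:F * k = n%:F -> mul_num k d = n.
Proof.
move=> dk; rewrite /mul_num; case: xgetP => [m _ /= | /(_ n)] //.
by rewrite dk => /eqP; rewrite tofrac_eq => /eqP.
Qed.

Arguments mul_numE {k d n}.

(** [mul_num] is meaningful only at multiples of a denominator, so linearity in the fraction is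
    obtained at the multiples of a common denominator of [k] and [l]. *)
Lemma mul_num_linear (c : D) (k l : K) :
  exists2 d, d != 0 & forall e,
    mul_num (c%:F * k + l) (d * e) = c * mul_num k (d * e) + mul_num l (d * e).
Proof.
have [d [m [d0 dk]]] := frac_denom _ k.
have [d' [n [d'0 dl]]] := frac_denom _ l.
exists (d * d') => [|e]; first by rewrite mulf_neq0.
have Ek : mul_num k (d * d' * e) = m * d' * e.
  by apply: mul_numE; rewrite !tofracM -dk; ring.
have El : mul_num l (d * d' * e) = n * d * e.
  by apply: mul_numE; rewrite !tofracM -dl; ring.
apply: mul_numE; rewrite Ek El tofracD !tofracM -dk -dl; ring.
Qed.

(** These are the functions with zero germ, where two functions have the same germ if they agree on
    all multiples of some non-zero element. *)
Definition eventually0 (f : D -> A) : Prop :=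
  exists2 d, d != 0 & forall e, f (d * e) = 0.

Lemma eventually0_module :
  exists (P : lmodType D) (p : {linear (D -> A) -> P}),
    forall f, p f = 0 <-> eventually0 f.
Proof.
apply: quotient_module => [|f g [d d0 fd] [e e0 ge]|a f [d d0 fd]].
- by exists 1 => //; exact: oner_neq0.
- exists (d * e) => [|c]; first by rewrite mulf_neq0.
  by rewrite !fctE -mulrA fd mulrCA ge addr0.
- by exists d => // e; rewrite !fctE fd scaler0.
Qed.

(* The germ of [d |-> d k a] on the multiples [d] of a denominator of [k]
   stands for [k a] in the localization of [A]. *)
Lemma localization_exists (Atf : torsion_free A) :
  exists (P : lmodType D) (phi : {bilinear A -> restr K^o -> P}),
    forall a, phi a (1 : K) = 0 -> a = 0.
Proof.
have [P [p kerp]] := eventually0_module.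
pose F (a : A) (k : restr K^o) (d : D) : A := mul_num k d *: a.
pose phi a k := p (F a k).
have pP f g : eventually0 (f - g) -> p f = p g.
  by move=> /kerp; rewrite linearB => /subr0_eq.
have bil : bilinear_for *:%R *:%R phi.
  split=> [k c a b | a c k l]; rewrite /phi -linearP; apply: pP.
    exists 1 => [|e]; first exact: oner_neq0.
    by rewrite !fctE /F scalerDr !scalerA mulrC subrr.
  have [d d0 lin] := mul_num_linear c k l.
  exists d => // e; rewrite !fctE /F scalerA -scalerDl.
  by rewrite -[c *: k + l]/(c%:F * (k : K) + (l : K)) lin mulrC subrr.
pose bphi := bilinear_isBilinear.Build D A (restr K^o) P *:%R *:%R phi bil.
pose Phi : {bilinear A -> restr K^o -> P} := HB.pack phi bphi.
exists P, Phi => a /kerp [d d0 Fd]; apply: (Atf d a) => //.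
(* The numerator of the fraction [1] over the denominator [d] is [d], so [d *: a = 0]. *)
by move: (Fd 1); rewrite /F (mul_numE (n := d)) // !mulr1.
Qed.

Variables (B : algType K) (t : {bilinear A -> restr K^o -> restr B}).
Hypothesis Bt : is_tensor_algebra t.

(** A bilinear map that separates the pairs [(a, 1)] factors through [t], so [t] separates them
    too. *)
Lemma iotaA_inj : torsion_free A -> injective (iotaA t).
Proof.
move=> /localization_exists[P [phi phi0]] a b.
have [g [gE _]] := tensor_universal Bt phi.
rewrite /iotaA => /(congr1 g); rewrite !gE => E; apply/subr0_eq/phi0.
by rewrite linearBl E subrr.
Qed.

Lemma iotaA_zmod : zmod_morphism (iotaA t).
Proof. by move=> a b; exact: linearBl. Qed.

Lemma iotaA_monoid : monoid_morphism (iotaA t).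
Proof.
split; first exact: tensor_one.
by move=> a b; rewrite /iotaA -[in LHS](mulr1 1) (tensor_mul Bt).
Qed.

Lemma iotaAZ d a : iotaA t (d *: a) = d%:F *: iotaA t a.
Proof. exact: linearZl_LR. Qed.

(* The quotient of [B] by the fractions receives only the zero map, since it
   kills all pure tensors. *)
Lemma iotaA_denom (b : B) :
  exists d a, d != 0 /\ d%:F *: b = iotaA t a.
Proof.
pose N (b : restr B) := exists d a, d != 0 /\ d%:F *: (b : B) = iotaA t a.
have iotaD a a' : iotaA t (a + a') = iotaA t a + iotaA t a'.
  exact: linearDl.
have [|x y [d [a [d0 da]]] [e [a' [e0 ea]]]|c x [d [a [d0 da]]]|P [p kerp]] :=
    @quotient_module D (restr B) N.
- by exists 1, 0; rewrite oner_neq0 scaler0 /iotaA linear0l.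
- exists (d * e), (e *: a + d *: a'); rewrite mulf_neq0 //; split=> //.
  rewrite iotaD !iotaAZ -da -ea !scalerA -!rmorphM [e * d]mulrC.
  exact: scalerDr.
- exists d, (c *: a); split=> //; rewrite iotaAZ -da.
  by rewrite -[c *: x]/(c%:F *: (x : B)) !scalerA mulrC.
apply/(kerp b).
pose zero (a : A) (k : restr K^o) : P := 0.
have bil : bilinear_for *:%R *:%R zero.
  by split=> a c u v; rewrite /= scaler0 addr0.
pose bzero := bilinear_isBilinear.Build D A (restr K^o) P *:%R *:%R zero bil.
pose Zero : {bilinear A -> restr K^o -> P} := HB.pack zero bzero.
have [g [_ g_uniq]] := tensor_universal Bt Zero.
(* Both [p] and [\0] induce the zero bilinear map: if [d k = n], then [d] times the tensor of [a]
   and [k] is the image of [n *: a]. Uniqueness makes them equal. *)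
rewrite (g_uniq p) => [|a k]; last first.
  apply/kerp; have [d [n [d0 dk]]] := frac_denom _ k.
  exists d, (n *: a); split=> //; rewrite iotaAZ /iotaA -!(tensor_scale Bt).
  by rewrite dk mulr1.
by rewrite -(g_uniq \0).
Qed.
End TensorAlgebra.

Arguments iotaA_inj {D A B t}.

(** * Null polynomials modulo [dA] *)

Section NullPolynomialsModulo.
Variables (D : idomainType) (A : algType D) (S : set A).

Definition null_mod (d : D) (F : {poly A}) : Prop :=
  forall s, S s -> F.[s] \in dA d.

(** Null polynomials always form an additive group, and coefficientwise reduction maps [A[x]] onto
    [(A/dA)[x]], so only absorption on the right has to be transported. *)
Lemma null_mod_right_ideal (d : D) :
  right_null_ideal_set (coset_set d S) <->
  forall F G, null_mod d F -> null_mod d (F * G).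
Proof.
have dA0 (a : A) : pi_dA d a = 0 <-> a \in dA d.
  have pi0 : pi_dA d (0 : A) = 0.
    exact: (raddf0 (\pi_(Quotient.quot (dA d))%qT)).
  by have := pi_dA_eq d a 0; rewrite pi0 subr0.
have [nz|z] := pselect ((1 : quot_dA A d) != 0); last first.
  split=> [_ F G _ s _ | _ /z //].
  (* When [A/dA] is the zero ring, [1] lies in [dA], and so does every value. *)
  rewrite -[_.[s]]mulr1; apply/dA_mull/dA0.
  by move/negP: z; rewrite negbK => /eqP.
have piB : zmod_morphism (pi_dA d : A -> nontriv nz).
  by move=> a b; exact: (raddfB (\pi_(Quotient.quot (dA d))%qT)).
have piM : monoid_morphism (pi_dA d : A -> nontriv nz).
  by split=> // a b; exact: pi_dA_mul.
pose mB := GRing.isZmodMorphism.Build A (nontriv nz) _ piB.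
pose mM := GRing.isMonoidMorphism.Build A (nontriv nz) _ piM.
pose pi : {rmorphism A -> nontriv nz} :=
  HB.pack (pi_dA d : A -> nontriv nz) mB mM.
have nullE F : null_polys (coset_set d S : set (nontriv nz)) (map_poly pi F)
               <-> null_mod d F.
  split=> [nF s Ss | nF _ [s Ss <-]].
    by apply/dA0; rewrite -[LHS](horner_map pi); apply: nF; exists s.
  by rewrite (horner_map pi); apply/dA0/nF.
have lift (f : {poly nontriv nz}) : exists F, f = map_poly pi F.
  exists (\poly_(i < size f) sval (pi_dAP (f`_i : quot_dA A d))).
  apply/polyP => i; rewrite coef_map coef_poly.
  case: ltnP => [_ | le_i]; last first.
    by rewrite nth_default //; exact/esym/(rmorph0 pi).
  exact: (svalP (pi_dAP (f`_i : quot_dA A d))).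
split=> [/(_ nz)[_ _ idl] F G nF | idl nz'].
  by apply/nullE; rewrite rmorphM; apply/idl/nullE.
(* The type [nontriv nz'] depends on its proof, which must be identified with the one used for
   [pi]. *)
rewrite (Prop_irrelevance nz' nz); split=> [s _ | f g nf ng s Ss | f g].
- by rewrite horner0.
- by rewrite hornerD hornerN nf // ng // subrr.
have [[F ->] [G ->]] := (lift f, lift g).
by rewrite -rmorphM => /nullE nF; apply/nullE/idl.
Qed.

End NullPolynomialsModulo.

Arguments null_mod {D A} S d F.

(** Since ['X] is central, a term [c 'X^k] of [f] contributes [c * g.[x] * x ^+ k]; so [g] enters
    only through its value at [x]. *)
Lemma horner_mul_value (R : nzRingType) (f g : {poly R}) (x : R) :
  (f * g).[x] = (f * g.[x]%:P).[x].
Proof.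
elim/poly_ind: f => [|f c IHf]; first by rewrite !mul0r.
rewrite !mulrDl !hornerD !hornerCM hornerC.
by rewrite -!mulrA -!commr_polyX !mulrA !hornerMX IHf.
Qed.

(** * Integer-valued polynomials and their products *)

Section Ringsets.
Variables (D : idomainType) (A : algType D) (B : algType {fraction D}).
Variables (iota : {rmorphism A -> B}) (S : set A).
Local Notation "x %:F" := (@FracField.tofrac D x).
Hypothesis iota_inj : injective iota.
Hypothesis iotaZ : forall d a, iota (d *: a) = d%:F *: iota a.
Hypothesis iota_denom : forall b, exists d a, d != 0 /\ d%:F *: b = iota a.

(** This is [Int_r] for a bundled ring morphism, to which [horner_map] applies. *)
Definition int_valued (f : {poly B}) : Prop :=
  forall s, S s -> range iota f.[iota s].

(** Denominators of the coefficients are multiplied together. Polynomials over [B] are scaled by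
    elements of [B], hence the form [d%:F%:A]. *)
Lemma poly_denom (f : {poly B}) :
  exists d F, d != 0 /\ d%:F%:A *: f = map_poly iota F.
Proof.
elim/poly_ind: f => [|f b [d [F [d0 dF]]]].
  by exists 1, 0; rewrite oner_neq0 scaler0 map_poly0.
have [e [a [e0 ea]]] := iota_denom b.
exists (d * e), (e%:A *: F * 'X + (d *: a)%:P); rewrite mulf_neq0 //.
split=> //; have iotaA c : iota c%:A = c%:F%:A by rewrite iotaZ rmorph1.
rewrite [RHS]rmorphD [X in _ = X + _]rmorphM /= map_polyX map_polyC map_polyZ /=.
rewrite iotaA -dF scalerA mulr_algl scalerA -rmorphM iotaZ -ea scalerA -rmorphM.
rewrite [e * d]mulrC.
by rewrite scalerDr scalerAl -[_ *: b%:P]mul_polyC -polyCM mulr_algl.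
Qed.

(** Evaluation gives [d f(s) = F(s)] in [B]. Injectivity of [iota] brings [F(s) = d a] back to [A];
    conversely, the non-zero [d] cancels in the [K]-space [B]. *)
Lemma int_valuedE (d : D) (f : {poly B}) (F : {poly A}) :
  d != 0 -> d%:F%:A *: f = map_poly iota F ->
  int_valued f <-> null_mod S d F.
Proof.
move=> d0 dF.
have dFs s : d%:F *: f.[iota s] = iota F.[s].
  by rewrite -horner_map -dF hornerZ mulr_algl.
split=> [intf s Ss | nF s Ss].
  have [a _ fs] := intf s Ss; apply/asboolP; exists a.
  by apply: iota_inj; rewrite iotaZ -dFs fs.
have /asboolP[a Fs] := nF s Ss; exists a => //.
apply: (@scalerI _ _ d%:F); first by rewrite tofrac_eq0.
by rewrite -iotaZ dFs Fs.
Qed.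

Arguments int_valuedE {d f F}.

Lemma int_valued_mulP :
  (forall f g, int_valued f -> int_valued g -> int_valued (f * g)) <->
  (forall d, d != 0 -> forall F G, null_mod S d F -> null_mod S d (F * G)).
Proof.
split=> [intM d d0 F G nF | nullM f g].
  pose f := (d%:F^-1)%:A *: map_poly iota F.
  have df : d%:F%:A *: f = map_poly iota F.
    by rewrite scalerA mulr_algl scalerA divff ?tofrac_eq0 // !scale1r.
  have dfG : d%:F%:A *: (f * map_poly iota G) = map_poly iota (F * G).
    by rewrite scalerAl df rmorphM.
  apply/(int_valuedE d0 dfG)/intM; first exact/(int_valuedE d0 df).
  by move=> s _; rewrite horner_map; exists G.[s].
have [d [F [d0 dF]]] := poly_denom f.
move=> /(int_valuedE d0 dF) nF intg.
move=> s Ss; have [a _ ga] := intg s Ss.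
rewrite horner_mul_value -ga.
have dFa : d%:F%:A *: (f * (iota a)%:P) = map_poly iota (F * a%:P).
  by rewrite rmorphM /= map_polyC -dF scalerAl.
(* With [a] fixed, [f a] is integer-valued on all of [S], so [s] is generalized again. *)
by move: s Ss {ga}; apply/(int_valuedE d0 dFa)/nullM.
Qed.
End Ringsets.

Theorem theorem2p8 (D : idomainType) (A : algType D)
    (Afg : fin_gen_algebra A) (Atf : torsion_free A)
    (B : algType {fraction D})
    (t : {bilinear A -> restr {fraction D}^o -> restr B})
    (Bt : is_tensor_algebra t) (AKD : A_cap_K_eq_D t)
    (S : set A) :
  right_ringset t S <->
  (forall d : D, d != 0 -> right_null_ideal_set (coset_set d S)).
Proof.
pose mB := GRing.isZmodMorphism.Build A B _ (@iotaA_zmod _ _ _ t).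
pose mM := GRing.isMonoidMorphism.Build A B _ (@iotaA_monoid _ _ _ _ Bt).
pose iota : {rmorphism A -> B} := HB.pack (iotaA t) mB mM.
have ringsetP := @int_valued_mulP _ _ _ iota S (iotaA_inj Bt Atf)
  (@iotaAZ _ _ _ t) (@iotaA_denom _ _ _ _ Bt).
apply: (iff_trans ringsetP).
by split=> null d d0; apply/null_mod_right_ideal/null.
Qed.
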